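(* On $A=M_2(\mathbb{C})$ with its standard 2D calculus, quantum metric $g=\imath(s^2\otimes s^1-s^1\otimes s^2)$ and flat quantum Levi-Civita connection $\nabla s^i=2\vartheta\otimes s^i$, the data $$J=\zeta=\sigma^3,\quad C^1=\tfrac12(\sigma^1-\sigma^3),\quad C^2=\tfrac{\epsilon'}{2}(\sigma^1+\sigma^3),\quad \gamma=-\epsilon'\sigma^2,\quad \epsilon=\epsilon''=1,$$ with $\sigma_{\mathcal S}{}^i{}_j=\zeta^i{}_j[C^1,C^2]$ and inner spinor connection, gives a full geometrically realised spectral triple which is even of KO-dimension $n=0$ if $\epsilon'=-1$, with $$({\not\!D}\psi)_\beta=-\frac{\imath}{4}\Big([-\sigma^1+\sigma^2,\psi_\alpha]\,\sigma^{1\,\alpha}{}_\beta+\{\sigma^1+\sigma^2,\psi_\alpha\}\,\sigma^{3\,\alpha}{}_\beta\Big),$$ and of KO-dimension $n=1$, ignoring $\gamma$, if $\epsilon'=1$, with $$({\not\!D}\psi)_\beta=\frac{\imath}{4}\Big(\{\sigma^1+\sigma^2,\psi_\alpha\}\,\sigma^{1\,\alpha}{}_\beta+[-\sigma^1+\sigma^2,\psi_\alpha]\,\sigma^{3\,\alpha}{}_\beta\Big).$$ Here Pauli matrices without spinor indices are elements of $A$, multiplying the components $\psi_\alpha\in A$, and those with indices ${}^\alpha{}_\beta$ act on spinor indices (sum over $\alpha$).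
   Context: **Calculus.** $\Omega^1(M_2(\mathbb{C}))$ is free with central self-adjoint basis $s^1,s^2$; with Pauli matrices $\sigma^1=\begin{pmatrix}0&1\\1&0\end{pmatrix}$, $\sigma^2=\begin{pmatrix}0&-\imath\\\imath&0\end{pmatrix}$, $\sigma^3=\begin{pmatrix}1&0\\0&-1\end{pmatrix}$ in $A$, it is inner with $da=[\vartheta,a]$, $\vartheta=\frac{\imath}{2}(\sigma^1s^1+\sigma^2s^2)$, so $da=(\partial_ia)s^i$, $\partial_i=\frac{\imath}{2}[\sigma^i,\ ]$. The exterior algebra has $s^1\wedge s^1=s^2\wedge s^2=\imath\mathrm{Vol}$, $s^1\wedge s^2=s^2\wedge s^1=0$, with $\mathrm{Vol}$ a central basis of $\Omega^2$. The connection $\nabla s^i=2\vartheta\otimes s^i=-\frac12\Gamma^i{}_{jk}s^j\otimes s^k$ has braiding $\sigma(s^i\otimes s^j)=-s^j\otimes s^i=\sigma^{ij}{}_{kl}s^k\otimes s^l$. The inverse metric is $g^{ij}=(s^i,s^j)$ with $g^{12}=-\imath=-g^{21}$, $g^{11}=g^{22}=0$. **Spinor data.** $\mathcal S$ is free with central basis $e^1,e^2$. Clifford action: $s^i\triangleright e^\alpha=C^{i\alpha}{}_\beta e^\beta$. Charge conjugation: $\mathcal J(ae^\alpha)=a^*J^\alpha{}_\beta e^\beta$. Even structure: $\gamma(e^\alpha)=\gamma^\alpha{}_\beta e^\beta$. Bimodule connection: $\nabla_{\mathcal S}e^\alpha=S^\alpha{}_{i\beta}s^i\otimes e^\beta$,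 with generalised braiding $\sigma_{\mathcal S}(e^\alpha\otimes s^j)=(\sigma_{\mathcal S}{}^j{}_i)^\alpha{}_\beta s^i\otimes e^\beta$; inner means $S_i=\frac{\imath}{2}(\sigma^i\,\mathrm{id}-\sum_j\sigma^j\sigma_{\mathcal S}{}^j{}_i)$ with $\sigma^i,\sigma^j\in A$ and $\sigma_{\mathcal S}{}^j{}_i$ matrices in spinor indices. Indices of $\zeta=\sigma^3$ are $\zeta^i{}_j$, $i,j\in\{1,2\}$. The Dirac operator is ${\not\!D}=\triangleright\circ\nabla_{\mathcal S}$, i.e. $({\not\!D}\psi)_\gamma=(\partial_i\psi_\alpha+\psi_\beta S^\beta{}_{i\alpha})C^{i\alpha}{}_\gamma$ for $\psi=\psi_\alpha e^\alpha$. **Full geometrically realised spectral triple** means all of the following, in matrix notation in spinor indices (row $\alpha$, column $\beta$), overline being entrywise conjugation (entrywise $*$ for entries in $A$): $\overline JJ=\epsilon\,\mathrm{id}$; $\sum_j\overline{S_j}J\sigma_{\mathcal S}{}^j{}_i=JS_i$; $\overline{C^i}J=\epsilon'J\sum_j\sigma_{\mathcal S}{}^i{}_jC^j$; if $\gamma$ is included, $\gamma^2=\mathrm{id}$, $\{C^i,\gamma\}=0$, $\overline\gamma J=\epsilon''J\gamma$, $[S_i,\gamma]=0$; covariance of $\triangleright$: $C^iS_j-\sigma^{ik}{}_{jl}S_kC^l=-\frac12\Gamma^i{}_{jk}C^k$; Clifford relations up to automorphism: for some invertible matrix $\varphi$ and nonzero constant $\kappa$, $(s^i\wedge s^j)\triangleright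 e^\alpha:=(C^jC^i\varphi)^\alpha{}_\beta e^\beta-\kappa g^{ij}e^\alpha$ is well defined on $\Omega^2\otimes_A\mathcal S$; and, for the inner product $\langle\phi_\alpha e^\alpha,\psi_\beta e^\beta\rangle=\sum_\alpha\mathrm{Tr}(\phi_\alpha^\dagger\psi_\alpha)$ on $\mathcal S$, ${\not\!D}$ is antihermitian, $\mathcal J$ is an antilinear isometry and $\gamma$ (if included) is hermitian. The corresponding Connes spectral triple has hermitian operator $D=\imath{\not\!D}$, for which $\mathcal JD=-\epsilon'D\mathcal J$. The signs ($\mathcal J^2=\epsilon$, $\mathcal JD=\epsilon'_DD\mathcal J$, $\mathcal J\gamma=\epsilon''\gamma\mathcal J$) are $(1,1,1)$ for $n=0$ and $(\epsilon,\epsilon'_D)=(1,-1)$ for $n=1$. *)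

(* Defs.v *)
From HB Require Import structures.
From mathcomp Require Import all_boot all_order all_algebra.
From mathcomp Require Import complex.
From mathcomp Require Import reals.

Set Implicit Arguments.
Unset Strict Implicit.
Unset Printing Implicit Defensive.

Import Order.TTheory GRing.Theory Num.Theory.
Local Open Scope ring_scope.

(* Indices i, j, ... of the central basis s^1, s^2 and alpha, beta, ... of the
   central basis e^1, e^2 range over 'I_2, so that 0 and 1 stand for the
   indices 1 and 2 of the text.

   Representation of the bimodules by components over A = M_2(C):
     Omega^1                 a_i s^i                     'I_2 -> A
     Omega^2                 a Vol                       A
     S                       psi_alpha e^alpha           'rV[A]_2
     Omega^1 (x)_A S         w_i,alpha s^i (x) e^alpha   'I_2 -> 'rV[A]_2
     Omega^1 (x) Omega^1 (x) S                           'I_2 -> 'I_2 -> 'rV[A]_2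
     Omega^2 (x)_A S         w_alpha Vol (x) e^alpha     'rV[A]_2
   Spinor matrices M^alpha_beta (row alpha, column beta) act on component rows
   from the right.  On psi : 'rV[A]_2 the left action of a : A is a *: psi and
   the right action is psi *m a%:M. *)

Definition mx2 (T : Type) (a b c d : T) : 'M[T]_2 :=
  \matrix_(i, j) (if i == 0 then (if j == 0 then a else b)
                  else (if j == 0 then c else d)).

Definition comm (T : pzRingType) (a b : T) : T := a * b - b * a.
Definition acomm (T : pzRingType) (a b : T) : T := a * b + b * a.

Section Calculus.
Variable C : numClosedFieldType.

Notation A := 'M[C]_2.

Definition sigma1 : A := mx2 0 1 1 0.
Definition sigma2 : A := mx2 0 (- 'i) 'i 0.
Definition sigma3 : A := mx2 1 0 0 (-1).
Definition pauli (i : 'I_2) : A := if i == 0 then sigma1 else sigma2.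

Definition star (a : A) : A := map_mx Num.conj a^T.

Definition theta (i : 'I_2) : A := ('i / 2) *: pauli i.

(* d a = [theta, a] = (partial i a) s^i, the s^i being central. *)
Definition partial (i : 'I_2) (a : A) : A := comm (theta i) a.

(* s^i /\ s^j = wedge i j Vol *)
Definition wedge (i j : 'I_2) : C := if i == j then 'i else 0.

(* g = metric i j s^i (x) s^j *)
Definition metric : 'M[C]_2 := mx2 0 (- 'i) 'i 0.

(* g^{ij} = (s^i, s^j) *)
Definition inverse_metric : 'M[C]_2 := mx2 0 (- 'i) 'i 0.

Lemma inverse_metricP : inverse_metric *m metric = 1%:M.
Proof.
apply/matrixP=> i j; rewrite !mxE !big_ord_recl big_ord0 !mxE /=.
by case: i j => [[|[|//]] ?] [[|[|//]] ?] /=;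
  rewrite ?(mul0r, mulr0, add0r, addr0) ?mulNr ?mulrN -?expr2 ?sqrCi ?opprK.
Qed.

(* Gamma^i_{jk}, from nabla s^i = 2 theta (x) s^i
   = - 1/2 Gamma^i_{jk} s^j (x) s^k *)
Definition christoffel (i j k : 'I_2) : A :=
  if k == i then - (4 *: theta j) else 0.

(* sigma^{ij}_{kl}, from
   sigma (s^i (x) s^j) = - s^j (x) s^i = sigma^{ij}_{kl} s^k (x) s^l *)
Definition braid (i j k l : 'I_2) : C :=
  if (k == j) && (l == i) then -1 else 0.

(* A complex spinor matrix viewed with entries in A. *)
Definition emb (M : 'M[C]_2) : 'M[A]_2 := map_mx scalar_mx M.

(* J, C^i, sigma_S^j_i (as [sbraid j i]) have constant entries; the entries of
   S_i are in A. *)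
Record spinor_data := SpinorData {
  chargeJ : 'M[C]_2;
  cliffC : 'I_2 -> 'M[C]_2;
  sbraid : 'I_2 -> 'I_2 -> 'M[C]_2;
  connS : 'I_2 -> 'M[A]_2 }.

Definition inner_connS (sb : 'I_2 -> 'I_2 -> 'M[C]_2) (i : 'I_2) : 'M[A]_2 :=
  (('i / 2)%:M : A) *:
    ((pauli i)%:M - \sum_j pauli j *: emb (sb j i)).

Section Operators.
Variable X : spinor_data.

Definition nablaS (psi : 'rV[A]_2) : 'I_2 -> 'rV[A]_2 :=
  fun i => map_mx (partial i) psi + psi *m connS X i.

(* psi (x) (w_j s^j) |-> (psi w_j) sigma_S^j_i s^i (x) e *)
Definition sigmaS (psi : 'rV[A]_2) (w : 'I_2 -> A) : 'I_2 -> 'rV[A]_2 :=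
  fun i => \sum_j (psi *m (w j)%:M) *m emb (sbraid X j i).

Definition clifford_act (w : 'I_2 -> 'rV[A]_2) : 'rV[A]_2 :=
  \sum_i w i *m emb (cliffC X i).

Definition slashD (psi : 'rV[A]_2) : 'rV[A]_2 := clifford_act (nablaS psi).

Definition connesD (psi : 'rV[A]_2) : 'rV[A]_2 := ('i%:M : A) *: slashD psi.

Definition opJ (psi : 'rV[A]_2) : 'rV[A]_2 :=
  map_mx star psi *m emb (chargeJ X).

Definition op_grading (g : 'M[C]_2) (psi : 'rV[A]_2) : 'rV[A]_2 :=
  psi *m emb g.

Definition inner (phi psi : 'rV[A]_2) : C :=
  \sum_alpha \tr (star (phi 0 alpha) *m psi 0 alpha).

Definition bimodule_connection : Prop :=
  forall (psi : 'rV[A]_2) (a : A) (i : 'I_2),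
    nablaS (psi *m a%:M) i
    = nablaS psi i *m a%:M + sigmaS psi (partial^~ a) i.

Definition covariant_clifford : Prop :=
  forall i j : 'I_2,
    emb (cliffC X i) *m connS X j
      - \sum_k \sum_l ((braid i k j l)%:M : A) *:
                        (connS X k *m emb (cliffC X l))
    = \sum_k (- 2^-1 *: christoffel i j k) *: emb (cliffC X k).

Definition wedgeS (w : 'I_2 -> 'I_2 -> 'rV[A]_2) : 'rV[A]_2 :=
  \sum_i \sum_j ((wedge i j)%:M : A) *: w i j.

(* s^i (x) s^j (x) e^alpha |-> (C^j C^i phi)^alpha_beta e^beta
                               - kappa g^{ij} e^alpha *)
Definition clifford_act2 (phi : 'M[C]_2) (kappa : C)
    (w : 'I_2 -> 'I_2 -> 'rV[A]_2) : 'rV[A]_2 :=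
  \sum_i \sum_j w i j *m
    emb (cliffC X j *m cliffC X i *m phi - (kappa * inverse_metric i j)%:M).

(* Well defined on Omega^2 (x)_A S: factors through wedgeS. *)
Definition clifford_relations : Prop :=
  exists (phi : 'M[C]_2) (kappa : C),
    [/\ phi \in unitmx, kappa != 0 &
      forall w w' : 'I_2 -> 'I_2 -> 'rV[A]_2,
        wedgeS w = wedgeS w' ->
        clifford_act2 phi kappa w = clifford_act2 phi kappa w'].

Definition antilinear_isometry (T : 'rV[A]_2 -> 'rV[A]_2) : Prop :=
  (forall (c : C) (phi psi : 'rV[A]_2),
     T ((c%:M : A) *: phi + psi) = ((c^*)%:M : A) *: T phi + T psi) /\
  (forall phi psi : 'rV[A]_2, inner (T phi) (T psi) = (inner phi psi)^*).

Definition bar (M : 'M[C]_2) : 'M[C]_2 := map_mx Num.conj M.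

(* Entrywise, without transposition of the spinor indices. *)
Definition barA (M : 'M[A]_2) : 'M[A]_2 := map_mx star M.

Record realised_triple (eps eps' : C) : Prop := RealisedTriple {
  rt_bimodule : bimodule_connection;
  rt_JJ : bar (chargeJ X) *m chargeJ X = eps%:M;
  rt_SJ : forall i,
    \sum_j barA (connS X j) *m emb (chargeJ X) *m emb (sbraid X j i)
    = emb (chargeJ X) *m connS X i;
  rt_CJ : forall i,
    bar (cliffC X i) *m chargeJ X
    = eps' *: (chargeJ X *m \sum_j sbraid X i j *m cliffC X j);
  rt_covariant : covariant_clifford;
  rt_clifford : clifford_relations;
  rt_antiherm : forall phi psi, inner phi (slashD psi) = - inner (slashD phi) psi;
  rt_isometry : antilinear_isometry opJ }.

Record even_realised_triple (g : 'M[C]_2) (eps eps' eps'' : C) : Prop :=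
  EvenRealisedTriple {
  ert_triple : realised_triple eps eps';
  ert_gg : g *m g = 1%:M;
  ert_Cg : forall i, acomm (cliffC X i) g = 0;
  ert_gJ : bar g *m chargeJ X = eps'' *: (chargeJ X *m g);
  ert_Sg : forall i, comm (connS X i) (emb g) = 0;
  ert_herm : forall phi psi,
    inner phi (op_grading g psi) = inner (op_grading g phi) psi }.

(* KO-dimension in terms of the hermitian operator D = i slashD:
   (J^2, J D = +- D J, J gamma = +- gamma J) has signs (1, 1, 1) for n = 0,
   and (J^2, J D = +- D J) has signs (1, -1) for n = 1. *)
Definition KO_dimension_0 (g : 'M[C]_2) : Prop :=
  [/\ forall psi, opJ (opJ psi) = psi,
      forall psi, opJ (connesD psi) = connesD (opJ psi) &
      forall psi, opJ (op_grading g psi) = op_grading g (opJ psi)].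

Definition KO_dimension_1 : Prop :=
  (forall psi, opJ (opJ psi) = psi) /\
  (forall psi, opJ (connesD psi) = - connesD (opJ psi)).

End Operators.

Definition zeta : 'M[C]_2 := sigma3.

Definition C_data (eps' : C) (i : 'I_2) : 'M[C]_2 :=
  if i == 0 then 2^-1 *: (sigma1 - sigma3)
  else (eps' / 2) *: (sigma1 + sigma3).

Definition sbraid_data (eps' : C) (i j : 'I_2) : 'M[C]_2 :=
  zeta i j *: comm (C_data eps' 0) (C_data eps' 1).

Definition spinor_M2 (eps' : C) : spinor_data :=
  SpinorData zeta (C_data eps') (sbraid_data eps')
             (inner_connS (sbraid_data eps')).

Definition gamma_data (eps' : C) : 'M[C]_2 := - eps' *: sigma2.

End Calculus.

Arguments sigma1 {C}.
Arguments sigma2 {C}.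
Arguments sigma3 {C}.

(* Main.v *)
Require Import Defs.
From mathcomp Require Import all_boot all_order all_algebra.
From mathcomp Require Import complex.
From mathcomp Require Import reals.
From mathcomp Require Import ring.

Import Order.TTheory GRing.Theory Num.Theory.
Local Open Scope ring_scope.

(** Write theta_i = (i/2) sigma^i for the components of the element making the
    calculus inner; they are antihermitian.  For an inner spinor connection
    the term psi theta of the connection cancels the one in the differential
    [theta, psi], which leaves

      nabla_S psi = theta_i psi s^i - sigma_S (psi (x) theta),

    for which the bimodule rule is immediate, since theta a - a theta = d a.

    For the rest, the only features of the matrices C^1, C^2 that matter are
    that they are real symmetric, anticommute, square to 1/2 and satisfy
    C^1 zeta = - eps' zeta C^2 and C^2 zeta = - eps' zeta C^1.  Put
    K = [C^1, C^2] = 2 C^1 C^2.  Then K is real antisymmetric, K^2 = - 1, K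
    anticommutes with C^1, C^2 and zeta, and K C^1 = - C^2, K C^2 = C^1.  Since
    sigma_S^i_j = zeta^i_j K with zeta = diag(1, -1), this gives

      S_1 = theta_1 (1 - K),      S_2 = theta_2 (1 + K),

      slashD psi = (theta_1 psi + psi theta_2) C^1
                 + (theta_2 psi + psi theta_1) C^2.

    The axioms are read off from these formulas.  The Dirac operator is
    antihermitian because the theta_i are and the C^i are hermitian; it
    satisfies J slashD = eps' slashD J because the conjugation exchanges left
    and right multiplication, which amounts to exchanging the factors of C^1
    and C^2, as zeta does; covariance holds because
    {C^i, S_j} = 2 theta_j C^i, the K-part dropping out.  The Clifford relations
    hold with phi = K and kappa = i/2: C^j C^i K - kappa g^ij vanishes for
    i <> j and equals K/2 for i = j.  The grading is gamma = - i K, so that its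
    axioms repeat those of K.  Finally both displayed Dirac operators are the
    formula above with C^1 and C^2 expanded in Pauli matrices. *)

(** * Linear algebra over the calculus *)

Lemma ord2P (i : 'I_2) : i = 0 \/ i = 1.
Proof. by case: i => [[|[|//]] ?]; [left|right]; apply/val_inj. Qed.

Lemma sum_ord2 (V : nmodType) (F : 'I_2 -> V) : \sum_i F i = F 0 + F 1.
Proof. by rewrite !big_ord_recl big_ord0 addr0; congr (_ + F _); apply/val_inj. Qed.

Ltac case_entries :=
  let j := fresh "j" in let k := fresh "k" in
  apply/matrixP; intros j k; destruct (ord2P j) as [->| ->];
  destruct (ord2P k) as [->| ->].

Ltac mx_entries :=
  case_entries;
  rewrite /C_data /zeta /gamma_data /sigma1 /sigma2 /sigma3 /= !(mxE, sum_ord2) /=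
    ?(mulr1n, mulr0n).

Section SpinorLinearAlgebra.
Variable C : numClosedFieldType.
Notation A := 'M[C]_2.
Implicit Types (a b : A) (M N : 'M[C]_2) (psi phi : 'rV[A]_2) (c : C).

Lemma starD a b : star (a + b) = star a + star b.
Proof. by rewrite /star linearD map_mxD. Qed.

Lemma starM a b : star (a *m b) = star b *m star a.
Proof. by rewrite /star trmx_mul map_mxM. Qed.

Lemma starZ c a : star (c *: a) = c^* *: star a.
Proof. by rewrite /star linearZ map_mxZ. Qed.

Lemma star_sum (I : finType) (F : I -> A) : star (\sum_i F i) = \sum_i star (F i).
Proof.
apply: (big_morph _ starD).
by rewrite /star trmx0 map_mx0.
Qed.

Lemma starK : involutive (@star C).
Proof. by move=> a; apply/matrixP=> i j; rewrite !mxE conjCK. Qed.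

Lemma star_scalar c : star c%:M = (c^*)%:M.
Proof. by rewrite /star tr_scalar_mx map_scalar_mx. Qed.

Lemma mxtrace_star a : \tr (star a) = (\tr a)^*.
Proof. by rewrite /mxtrace rmorph_sum; apply: eq_bigr => i _; rewrite !mxE. Qed.

Lemma star_pauli i : star (pauli C i) = pauli C i.
Proof.
by apply/matrixP=> j k; case: (ord2P i) => ->; case: (ord2P j) => ->;
  case: (ord2P k) => ->;
  rewrite /pauli /star /= !mxE /= ?(conjC0, conjC1) ?rmorphN /= ?conjCi ?opprK.
Qed.

Lemma star_theta i : star (theta C i) = - theta C i.
Proof.
rewrite /theta starZ star_pauli rmorphM /= conjCi fmorphV rmorph_nat.
by rewrite mulNr scaleNr.
Qed.

Lemma emb0 : emb (0 : 'M[C]_2) = 0.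
Proof. by rewrite /emb map_mx0. Qed.

Lemma emb1 : emb (1%:M : 'M[C]_2) = 1%:M.
Proof. by rewrite /emb map_scalar_mx. Qed.

Lemma embM M N : emb (M *m N) = emb M *m emb N.
Proof. by rewrite /emb map_mxM. Qed.

Lemma embD M N : emb (M + N) = emb M + emb N.
Proof. by rewrite /emb map_mxD. Qed.

Lemma embN M : emb (- M) = - emb M.
Proof. by rewrite /emb map_mxN. Qed.

Lemma embZ c M : emb (c *: M) = (c%:M : A) *: emb M.
Proof. by apply/matrixP=> i j; rewrite !mxE scalar_mxM. Qed.

Lemma mulmx_scalarE m n (X : 'M[A]_(m, n)) a i j :
  (X *m a%:M) i j = X i j *m a.
Proof.
rewrite !mxE (bigD1 j) //= big1 ?addr0 ?mxE ?eqxx ?mulr1n // => k /negPf kj.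
by rewrite mxE kj mulr0n mulr0.
Qed.

Lemma mulmx_embE psi M i j : (psi *m emb M) i j = \sum_k M k j *: psi i k.
Proof. by rewrite mxE; apply: eq_bigr => k _; rewrite mxE [_ * _]mul_mx_scalar. Qed.

(** Constant spinor matrices commute with the right action of A, although
    matrices over the noncommutative ring A do not form an A-algebra. *)
Lemma emb_scalarC M a : emb M *m a%:M = a *: emb M.
Proof.
apply/matrixP=> i j; rewrite mulmx_scalarE !mxE.
exact: (esym (scalar_mxC _ _)).
Qed.

Lemma emb_scaleE a (M N : 'M[C]_2) : emb M *m (a *: emb N) = a *: emb (M *m N).
Proof. by rewrite -(mul_scalar_mx a (emb N)) mulmxA emb_scalarC embM scalemxAl. Qed.

Lemma row_scalarC m n (X : 'M[A]_(m, n)) c :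
  X *m ((c%:M : A)%:M) = (c%:M : A) *: X.
Proof. by apply/matrixP=> i j; rewrite mulmx_scalarE mxE scalar_mxC. Qed.

Lemma row_embC psi M a : psi *m emb M *m a%:M = psi *m a%:M *m emb M.
Proof. by rewrite -!mulmxA emb_scalarC mul_scalar_mx. Qed.

Lemma row_embZ psi c M : psi *m emb (c *: M) = (c%:M : A) *: (psi *m emb M).
Proof. by rewrite embZ -mul_scalar_mx mulmxA row_scalarC scalemxAl. Qed.

Lemma bar_emb_row psi M :
  map_mx (@star C) (psi *m emb M) = map_mx (@star C) psi *m emb (bar M).
Proof.
apply/matrixP=> i j; rewrite mxE !mulmx_embE star_sum.
by apply: eq_bigr => k _; rewrite starZ !mxE.
Qed.

Lemma star_scale_row a psi :
  map_mx (@star C) (a *: psi) = map_mx (@star C) psi *m (star a)%:M.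
Proof.
by apply/matrixP=> i j; rewrite mulmx_scalarE !mxE starM.
Qed.

Lemma star_row_scalar a psi :
  map_mx (@star C) (psi *m a%:M) = star a *: map_mx (@star C) psi.
Proof. by apply/matrixP=> i j; rewrite mxE mulmx_scalarE starM !mxE. Qed.

Lemma star_rowD psi phi :
  map_mx (@star C) (psi + phi) = map_mx (@star C) psi + map_mx (@star C) phi.
Proof. by apply/matrixP=> i j; rewrite !mxE starD. Qed.

Lemma star_rowK psi : map_mx (@star C) (map_mx (@star C) psi) = psi.
Proof. by apply/matrixP=> i j; rewrite !mxE starK. Qed.

Lemma innerDr phi psi1 psi2 :
  inner phi (psi1 + psi2) = inner phi psi1 + inner phi psi2.
Proof.
rewrite /inner -big_split; apply: eq_bigr => k _.
by rewrite mxE mulmxDr linearD.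
Qed.

Lemma innerC phi psi : inner phi psi = (inner psi phi)^*.
Proof.
rewrite /inner rmorph_sum /=; apply: eq_bigr => k _.
by rewrite -mxtrace_star starM starK.
Qed.

Lemma innerDl phi1 phi2 psi :
  inner (phi1 + phi2) psi = inner phi1 psi + inner phi2 psi.
Proof. by rewrite innerC innerDr rmorphD /= -!innerC. Qed.

Lemma inner_scale a phi psi : inner phi (a *: psi) = inner (star a *: phi) psi.
Proof.
by apply: eq_bigr => k _; rewrite !mxE starM starK mulmxA.
Qed.

Lemma inner_scalar a phi psi :
  inner phi (psi *m a%:M) = inner (phi *m (star a)%:M) psi.
Proof.
apply: eq_bigr => k _; rewrite !mulmx_scalarE starM starK.
by rewrite mulmxA mxtrace_mulC mulmxA.
Qed.

Lemma inner_emb M phi psi :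
  inner phi (psi *m emb M) = inner (phi *m emb (bar M^T)) psi.
Proof.
rewrite /inner; under eq_bigr do rewrite mulmx_embE mulmx_sumr linear_sum /=.
rewrite exchange_big; apply: eq_bigr => k _ /=.
rewrite mulmx_embE star_sum mulmx_suml linear_sum /=.
apply: eq_bigr => l _; rewrite starZ !mxE conjCK.
by rewrite -scalemxAl -scalemxAr.
Qed.

Lemma inner_star phi psi :
  inner (map_mx (@star C) phi) (map_mx (@star C) psi) = (inner phi psi)^*.
Proof.
rewrite -innerC; apply: eq_bigr => k _.
by rewrite !mxE starK mxtrace_mulC.
Qed.

Lemma opJ_isometry (X : spinor_data C) :
  chargeJ X *m bar (chargeJ X)^T = 1%:M -> antilinear_isometry (opJ X).
Proof.
move=> JJ; split=> [c phi psi|phi psi].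
  rewrite /opJ star_rowD star_scale_row star_scalar row_scalarC mulmxDl.
  by rewrite -scalemxAl.
by rewrite /opJ inner_emb -mulmxA -embM JJ emb1 mulmx1 inner_star.
Qed.

(** The two summands of the Dirac operator have this shape.  Left and right
    multiplication by a, b and the spinor matrix M act on separate tensor
    factors, and a product of commuting antihermitian and hermitian operators
    is antihermitian. *)
Lemma inner_two_sided a b M phi psi :
  star a = - a -> star b = - b -> bar M^T = M ->
  inner phi ((a *: psi + psi *m b%:M) *m emb M)
  = - inner ((a *: phi + phi *m b%:M) *m emb M) psi.
Proof.
move=> sa sb sM; rewrite inner_emb sM innerDr inner_scale inner_scalar sa sb.
rewrite -innerDl scaleNr raddfN mulmxN -opprD row_embC scalemxAl -mulmxDl.
by rewrite innerC (innerC _ psi) -rmorphN /inner; congr (_^*); rewrite -sumrN;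
  apply: eq_bigr => k _; rewrite !mxE mulmxN raddfN.
Qed.

(** The star reverses products, so that left multiplication by a turns into
    right multiplication by its adjoint: a and b change places. *)
Lemma star_two_sided a b M N psi :
  star a = - a -> star b = - b ->
  map_mx (@star C) ((a *: psi + psi *m b%:M) *m emb M) *m emb N
  = - ((b *: map_mx (@star C) psi + map_mx (@star C) psi *m a%:M)
       *m emb (bar M *m N)).
Proof.
move=> sa sb; rewrite bar_emb_row -mulmxA -embM -mulNmx star_rowD.
rewrite star_scale_row star_row_scalar sa sb scaleNr raddfN mulmxN.
by rewrite opprD addrC.
Qed.

Lemma inner_connSE (sb : 'I_2 -> 'I_2 -> 'M[C]_2) i :
  inner_connS sb i = (theta C i)%:M - \sum_j theta C j *: emb (sb j i).
Proof.
rewrite /inner_connS scalerBr scaler_sumr /theta; congr (_ - _).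
  by rewrite scale_scalar_mx [_ * _]mul_scalar_mx.
by apply: eq_bigr => j _; rewrite scalerA [_ * _]mul_scalar_mx.
Qed.

(** In partial_i psi = theta_i psi - psi theta_i the second term cancels the
    term psi theta_i of the connection. *)
Lemma inner_nablaSE (X : spinor_data C) psi i :
  connS X = inner_connS (sbraid X) ->
  nablaS X psi i = theta C i *: psi - sigmaS X psi (@theta C) i.
Proof.
move=> SX; rewrite /nablaS SX inner_connSE mulmxBr addrA mulmx_sumr.
congr (_ - _).
  by apply/matrixP=> k l; rewrite mxE mulmx_scalarE !mxE /partial /comm subrK.
by apply: eq_bigr => j _; rewrite -mulmxA mul_scalar_mx.
Qed.

Lemma sigmaS_right_mul (X : spinor_data C) psi a (w : 'I_2 -> A) i :
  sigmaS X (psi *m a%:M) w i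
  = sigmaS X psi w i *m a%:M - sigmaS X psi (fun j => comm (w j) a) i.
Proof.
rewrite /sigmaS mulmx_suml -sumrB; apply: eq_bigr => j _.
rewrite row_embC -mulmxBl -!(mulmxA psi) -mulmxBr -!scalar_mxM -raddfB /=.
by rewrite /comm -!mulmxE opprB addrCA subrr addr0 mulmxA.
Qed.

(** Holds for every choice of generalised braiding: the failure of theta to
    commute with a is exactly d a. *)
Lemma inner_bimodule_connection (X : spinor_data C) :
  connS X = inner_connS (sbraid X) -> bimodule_connection X.
Proof.
move=> SX psi a i; rewrite !inner_nablaSE // sigmaS_right_mul.
by rewrite mulmxBl -scalemxAl opprB addrCA addrC.
Qed.

Lemma barA_scale a (M : 'M[C]_2) : star a = - a ->
  barA (a *: emb M) = - (a *: emb (bar M)).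
Proof.
move=> sa; apply/matrixP=> k l; rewrite !mxE starM star_scalar sa mulmxN.
by rewrite -scalar_mxC.
Qed.

(** The braiding is minus the flip, which turns the covariance of the
    Clifford action into a condition on an anticommutator. *)
Lemma braid_sum (F : 'I_2 -> 'I_2 -> 'M[A]_2) i j :
  \sum_k \sum_l ((braid C i k j l)%:M : A) *: F k l = - F j i.
Proof.
have b0 : ((0 : C)%:M : A) = 0 by exact: raddf0.
have b1 : ((-1 : C)%:M : A) = - 1 by exact: raddfN.
rewrite !sum_ord2 /braid; case: (ord2P i) => ->; case: (ord2P j) => -> /=;
  by rewrite ?(b0, b1, scale0r, add0r, addr0) scaleN1r.
Qed.

Lemma christoffel_sum (F : 'I_2 -> 'M[A]_2) i j :
  \sum_k (- 2^-1 *: christoffel C i j k) *: F k = (2 *: theta C j) *: F i.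
Proof.
have t2 : - 2^-1 *: - (4 *: theta C j) = 2 *: theta C j.
  by rewrite scaleNr scalerN opprK scalerA; congr (_ *: _); field.
rewrite !sum_ord2 /christoffel; case: (ord2P i) => -> /=;
  by rewrite t2 scaler0 scale0r ?add0r ?addr0.
Qed.

Lemma zeta00 : zeta C 0 0 = 1.
Proof. by rewrite mxE. Qed.

Lemma zeta11 : zeta C 1 1 = -1.
Proof. by rewrite mxE. Qed.

Lemma zeta_offdiag i j : j != i -> zeta C j i = 0.
Proof. by case: (ord2P i) => ->; case: (ord2P j) => -> //; rewrite mxE. Qed.

Lemma zeta_sq : zeta C *m zeta C = 1%:M.
Proof.
apply/matrixP=> j k; rewrite mxE sum_ord2.
by case: (ord2P j) => ->; case: (ord2P k) => ->;
  rewrite !mxE /= ?(mulr0, mul0r, add0r, addr0, mulrNN, mulr1).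
Qed.

Lemma tr_zeta : (zeta C)^T = zeta C.
Proof.
by apply/matrixP=> j k; case: (ord2P j) => ->; case: (ord2P k) => ->; rewrite !mxE.
Qed.

Lemma bar_zeta : bar (zeta C) = zeta C.
Proof.
by apply/matrixP=> j k; case: (ord2P j) => ->; case: (ord2P k) => ->;
  rewrite !mxE /= ?rmorphN ?rmorph1 ?rmorph0.
Qed.

Lemma mul2V : 2 * 2^-1 = 1 :> C.
Proof. by rewrite mulfV // pnatr_eq0. Qed.

End SpinorLinearAlgebra.

(** * Anticommuting pairs interchanged by the charge conjugation *)

(** What the proof retains of C^1, C^2 and of K = [C^1, C^2].  The relations
    with zeta say that conjugation by it exchanges C^1 and C^2 up to
    the sign - e, where e is the eps' of the triple.  Keeping c and K abstract
    also prevents rewriting from unfolding the concrete matrices. *)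
Record twisted_clifford_pair {C : numClosedFieldType} (e : C)
    (c : 'I_2 -> 'M[C]_2) (K : 'M[C]_2) : Prop := TwistedCliffordPair {
  pair_sign : e = 1 \/ e = -1;
  pair_sq : forall i, c i *m c i = (2^-1)%:M;
  pair_anticomm : c 1 *m c 0 = - (c 0 *m c 1);
  pair_bar : forall i, bar (c i) = c i;
  pair_tr : forall i, (c i)^T = c i;
  pair_zeta0 : c 0 *m zeta C = - e *: (zeta C *m c 1);
  pair_zeta1 : c 1 *m zeta C = - e *: (zeta C *m c 0);
  pair_comm : K = comm (c 0) (c 1) }.

Arguments pair_sign {C e c K}.
Arguments pair_sq {C e c K}.
Arguments pair_anticomm {C e c K}.
Arguments pair_bar {C e c K}.
Arguments pair_tr {C e c K}.
Arguments pair_zeta0 {C e c K}.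
Arguments pair_zeta1 {C e c K}.
Arguments pair_comm {C e c K}.

Section TwistedCliffordPair.
Variables (C : numClosedFieldType) (e : C) (c : 'I_2 -> 'M[C]_2) (K : 'M[C]_2).
Hypothesis cP : twisted_clifford_pair e c K.
Notation A := 'M[C]_2.
Notation Z := (zeta C).
Notation sb := (fun i j => Z i j *: K).
Notation X := (SpinorData Z c sb (inner_connS sb)).
Notation g := (- 'i *: K).

Lemma sign_sq : e * e = 1.
Proof. by case: (pair_sign cP) => ->; rewrite ?mulrNN mulr1. Qed.

Lemma volE : K = 2 *: (c 0 *m c 1).
Proof.
by rewrite (pair_comm cP) /comm -!mulmxE (pair_anticomm cP) opprK scaler_nat.
Qed.

Lemma c0_vol : c 0 *m K = c 1.
Proof.
rewrite volE -scalemxAr mulmxA (pair_sq cP) mul_scalar_mx scalerA.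
by rewrite mul2V scale1r.
Qed.

Lemma vol_c1 : K *m c 1 = c 0.
Proof.
rewrite volE -scalemxAl -mulmxA (pair_sq cP) mul_mx_scalar scalerA.
by rewrite mul2V scale1r.
Qed.

Lemma vol_anticomm i : K *m c i = - (c i *m K).
Proof.
case: (ord2P i) => ->; rewrite volE -scalemxAl -scalemxAr -scalerN.
  by rewrite -mulmxA (pair_anticomm cP) mulmxN.
by rewrite [in RHS]mulmxA (pair_anticomm cP) mulNmx opprK.
Qed.

Lemma vol_c0 : K *m c 0 = - c 1.
Proof. by rewrite vol_anticomm c0_vol. Qed.

Lemma c1_vol : c 1 *m K = - c 0.
Proof. by rewrite -vol_c1 vol_anticomm opprK. Qed.

Lemma vol_sq : K *m K = - 1%:M.
Proof.
rewrite {2}volE -scalemxAr mulmxA vol_c0 mulNmx (pair_sq cP) scalerN.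
by rewrite scale_scalar_mx mul2V.
Qed.

Lemma vol_zeta : K *m Z = - (Z *m K).
Proof.
rewrite volE -scalemxAl -mulmxA (pair_zeta1 cP) -scalemxAr mulmxA.
rewrite (pair_zeta0 cP).
rewrite -scalemxAl -mulmxA (pair_anticomm cP) mulmxN.
by rewrite !(scaleNr, scalerN, opprK) (scalerA e) sign_sq scale1r -scalemxAr.
Qed.

Lemma bar_vol : bar K = K.
Proof.
by rewrite volE /bar map_mxZ map_mxM -!/(bar _) !(pair_bar cP) /= rmorph_nat.
Qed.

Lemma tr_vol : K^T = - K.
Proof.
by rewrite volE linearZ /= trmx_mul !(pair_tr cP) (pair_anticomm cP) scalerN.
Qed.

Lemma vol_unit : K \in unitmx.
Proof.
have /mulmx1_unit[] // : K *m - K = 1%:M by rewrite mulmxN vol_sq opprK.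
Qed.

(** The matrix zeta is diagonal, so only one term of each contraction with
    the generalised braiding survives. *)
Lemma sum_sbraid (V : zmodType) (F : 'M[C]_2 -> 'I_2 -> V) i :
  (forall j, F 0 j = 0) -> \sum_j F (sb j i) j = F (Z i i *: K) i.
Proof.
move=> F0; rewrite (bigD1 i) //= big1 ?addr0 // => j ji.
by rewrite zeta_offdiag // scale0r.
Qed.

Lemma sigmaSE psi (w : 'I_2 -> A) i :
  sigmaS X psi w i = psi *m (w i)%:M *m emb (Z i i *: K).
Proof.
rewrite -(@sum_sbraid _ (fun M j => psi *m (w j)%:M *m emb M)) // => j.
by rewrite emb0 mulmx0.
Qed.

Lemma connSE i : connS X i = theta C i *: emb (1%:M - Z i i *: K).
Proof.
rewrite [LHS]inner_connSE.
rewrite (@sum_sbraid _ (fun M j => theta C j *: emb M)); last first.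
  by move=> j; rewrite emb0 scaler0.
by rewrite embD embN scalerBr emb1 scalemx1.
Qed.

Lemma nablaSE psi i :
  nablaS X psi i = theta C i *: psi - sigmaS X psi (@theta C) i.
Proof. exact: (@inner_nablaSE C X psi i erefl). Qed.

(** On the right of psi theta_i stand - K C^1 = C^2 for i = 1 and
    K C^2 = C^1 for i = 2, which is why the indices are exchanged. *)
Lemma slashDE psi :
  slashD X psi = (theta C 0 *: psi + psi *m (theta C 1)%:M) *m emb (c 0)
               + (theta C 1 *: psi + psi *m (theta C 0)%:M) *m emb (c 1).
Proof.
rewrite /slashD /clifford_act sum_ord2 !nablaSE !sigmaSE zeta00 zeta11.
rewrite scale1r scaleN1r /= !mulmxBl !mulmxDl.
rewrite -(mulmxA _ (emb K)) -(mulmxA _ (emb (- K))) -!embM.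
rewrite mulNmx vol_c0 vol_c1 !embN !mulmxN !opprK.
by rewrite -!addrA; congr (_ + _); rewrite addrC -!addrA addrCA.
Qed.

Lemma slashD_antiherm phi psi :
  inner phi (slashD X psi) = - inner (slashD X phi) psi.
Proof.
by rewrite !slashDE innerDr innerDl opprD; congr (_ + _);
  apply: inner_two_sided; rewrite ?star_theta ?(pair_tr cP) ?(pair_bar cP).
Qed.

(** The star exchanges the roles of theta_1 and theta_2 in each summand and
    moving zeta to the left of C^1 or C^2 replaces one by the other; both
    together exchange the two summands of the Dirac operator. *)
Lemma opJ_slashD psi : opJ X (slashD X psi) = (e%:M : A) *: slashD X (opJ X psi).
Proof.
rewrite /opJ !slashDE star_rowD mulmxDl !star_two_sided ?star_theta //.
rewrite !(pair_bar cP) [chargeJ X]/= (pair_zeta0 cP) (pair_zeta1 cP).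
rewrite !row_embZ.
rewrite addrC raddfN !scaleNr !opprK -scalerDr !embM !mulmxA.
by rewrite !mulmxDl !row_embC !scalemxAl.
Qed.

(** The additional sign comes from the antilinearity of J on the factor i. *)
Lemma opJ_connesD psi :
  opJ X (connesD X psi) = - (e%:M : A) *: connesD X (opJ X psi).
Proof.
rewrite /connesD {1}/opJ star_scale_row star_scalar conjCi row_scalarC -scalemxAl.
rewrite -/(opJ X _) opJ_slashD raddfN !scaleNr !scalerA.
by congr (- (_ *: _)); exact: scalar_mxC.
Qed.

Lemma opJK psi : opJ X (opJ X psi) = psi.
Proof.
by rewrite /opJ bar_emb_row star_rowK -mulmxA -embM bar_zeta zeta_sq emb1 mulmx1.
Qed.

Lemma chirality_zeta : bar g *m Z = Z *m g.
Proof.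
rewrite /bar map_mxZ -/(bar K) bar_vol /= rmorphN /= conjCi opprK.
by rewrite -scalemxAl vol_zeta -scalemxAr scaleNr scalerN.
Qed.

Lemma opJ_grading psi : opJ X (op_grading g psi) = op_grading g (opJ X psi).
Proof.
rewrite /opJ /op_grading bar_emb_row -!mulmxA -!embM.
by rewrite [chargeJ X]/= chirality_zeta.
Qed.

(** The part of S_j involving K anticommutes with C^i, so that
    {C^i, S_j} = 2 theta_j C^i, and this is - Gamma^i_jk C^k / 2. *)
Lemma pair_covariant : covariant_clifford X.
Proof.
move=> i j; rewrite braid_sum christoffel_sum opprK connSE [cliffC X]/=.
rewrite emb_scaleE -(scalemxAl (theta C j)) -embM -(scalerDr (theta C j)) -embD.
rewrite mulmxBr mulmxBl mulmx1 mul1mx -!(scalemxAr (Z j j)) -!(scalemxAl (Z j j)).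
rewrite vol_anticomm scalerN opprK addrACA addNr addr0.
by rewrite scaler_nat embD scalerDr -scalerDl.
Qed.

(** For i <> j the matrices C^j C^i K are multiples of the identity, since
    2 C^1 C^2 = K and K^2 = - 1, and kappa = i/2 makes them cancel against
    kappa g^ij.  For i = j there remains K/2, the same matrix for both i, so
    the action factors through the wedge product. *)
Lemma clifford_act2E w :
  clifford_act2 X K ('i / 2) w = ((- ('i / 2))%:M : A) *: wedgeS w *m emb K.
Proof.
rewrite /clifford_act2 /wedgeS scaler_sumr mulmx_suml; apply: eq_bigr => i _.
rewrite scaler_sumr mulmx_suml; apply: eq_bigr => j _.
have -> : ((- ('i / 2))%:M : A) *: (((wedge C i j)%:M : A) *: w i j) *m emb K
          = w i j *m emb ((- ('i / 2) * wedge C i j) *: K).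
  by rewrite row_embZ -2!scalemxAl scalerA [in RHS]scalar_mxM.
congr (_ *m emb _).
have ii : 'i / 2 * 'i = - 2^-1 :> C by rewrite mulrAC -expr2 sqrCi mulN1r.
(* This also fixes kappa: i kappa = - 1/2. *)
have c01 : c 0 *m c 1 *m K = (- 2^-1)%:M.
  by rewrite -mulmxA c1_vol mulmxN (pair_sq cP) raddfN.
case: (ord2P i) => ->; case: (ord2P j) => ->.
- by rewrite (pair_sq cP) mul_scalar_mx mxE mulr0 raddf0 subr0 mulNr ii opprK.
- rewrite (pair_anticomm cP) mulNmx c01 mxE /= mulrN ii opprK mulr0.
  by rewrite scale0r raddfN opprK subrr.
- by rewrite c01 mxE /= ii mulr0 scale0r subrr.
- by rewrite (pair_sq cP) mul_scalar_mx mxE mulr0 raddf0 subr0 mulNr ii opprK.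
Qed.

Lemma pair_clifford : clifford_relations X.
Proof.
exists K, ('i / 2); split=> [||w w' ww']; first exact: vol_unit.
  by rewrite mulf_neq0 ?neq0Ci // invr_eq0 pnatr_eq0.
by rewrite !clifford_act2E ww'.
Qed.

Lemma bar_sub_vol i : bar (1%:M - Z i i *: K) = 1%:M - Z i i *: K.
Proof.
rewrite /bar map_mxB map_mx1 map_mxZ -/(bar K) bar_vol.
by rewrite -[in RHS]bar_zeta [bar Z _ _]mxE.
Qed.

(** With z = zeta^i_i, z^2 = 1 and zeta K = - K zeta one gets
    (1 - z K) zeta z K = - zeta (1 - z K), and the sign is absorbed by
    theta_i being antihermitian. *)
Lemma pair_SJ i :
  \sum_j barA (connS X j) *m emb (chargeJ X) *m emb (sbraid X j i)
    = emb (chargeJ X) *m connS X i.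
Proof.
rewrite (@sum_sbraid _ (fun M j => barA (connS X j) *m emb Z *m emb M)); last first.
  by move=> j; rewrite emb0 mulmx0.
rewrite connSE barA_scale ?star_theta // bar_sub_vol emb_scaleE !mulNmx.
rewrite -!(scalemxAl (theta C i)) -!embM -(scalerN (theta C i)) -embN.
have zz : Z i i * Z i i = 1.
  by case: (ord2P i) => ->; rewrite ?zeta00 ?zeta11 ?mulrNN mulr1.
congr (_ *: emb _).
rewrite mulmxBl mul1mx -scalemxAl vol_zeta scalerN opprK mulmxDl mulmxBr mulmx1.
rewrite -!scalemxAl -!scalemxAr scalerA zz scale1r -mulmxA vol_sq mulmxN mulmx1.
by rewrite opprD opprK addrC.
Qed.

Lemma pair_CJ i :
  bar (cliffC X i) *m Z = e *: (Z *m \sum_j sbraid X i j *m cliffC X j).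
Proof.
rewrite (pair_bar cP) sum_ord2 /=.
case: (ord2P i) => ->; rewrite ?zeta00 ?zeta11 zeta_offdiag // scale0r mul0mx.
  by rewrite addr0 scale1r vol_c0 (pair_zeta0 cP) mulmxN scaleNr scalerN.
by rewrite add0r scaleN1r mulNmx vol_c1 (pair_zeta1 cP) mulmxN scaleNr scalerN.
Qed.

Lemma pair_realised_triple : realised_triple X 1 e.
Proof.
split.
- exact: inner_bimodule_connection.
- by rewrite bar_zeta zeta_sq.
- exact: pair_SJ.
- exact: pair_CJ.
- exact: pair_covariant.
- exact: pair_clifford.
- exact: slashD_antiherm.
- apply: opJ_isometry; rewrite [chargeJ X]/= tr_zeta bar_zeta; exact: zeta_sq.
Qed.

Lemma pair_even_realised_triple : even_realised_triple X g 1 e 1.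
Proof.
split.
- exact: pair_realised_triple.
- rewrite -scalemxAl -scalemxAr scalerA mulrNN -expr2 sqrCi vol_sq.
  by rewrite scaleN1r opprK.
- move=> i; rewrite /acomm -!mulmxE -scalemxAl -scalemxAr -scalerDr.
  by rewrite vol_anticomm subrr scaler0.
- by rewrite scale1r; exact: chirality_zeta.
- move=> i; rewrite /comm -!mulmxE connSE emb_scaleE -(scalemxAl (theta C i)).
  rewrite -embM -(scalerBr (theta C i)) -embN -embD.
  rewrite -scalemxAl -scalemxAr -scalerBr mulmxBl mulmxBr mul1mx mulmx1.
  by rewrite -scalemxAl -scalemxAr subrr scaler0 emb0 scaler0.
- move=> phi psi; rewrite /op_grading inner_emb; congr (inner (_ *m emb _) _).
  rewrite linearZ /= tr_vol /bar map_mxZ map_mxN -/(bar K) bar_vol /=.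
  by rewrite rmorphN /= conjCi opprK scalerN scaleNr.
Qed.

End TwistedCliffordPair.

(** * The Pauli data *)

Section PauliData.
Variables (C : numClosedFieldType) (e : C).
Hypothesis e_sign : e = 1 \/ e = -1.
Notation A := 'M[C]_2.

Lemma C_data_sq i : C_data e i *m C_data e i = (2^-1)%:M.
Proof. by case: e_sign => ->; case: (ord2P i) => ->; mx_entries; field. Qed.

Lemma C_data_anticomm : C_data e 1 *m C_data e 0 = - (C_data e 0 *m C_data e 1).
Proof. by mx_entries; field. Qed.

Lemma bar_C_data i : bar (C_data e i) = C_data e i.
Proof.
case: e_sign => ->; case: (ord2P i) => ->; mx_entries;
  by rewrite !(rmorphM, rmorphD, rmorphN, fmorphV, rmorph1, rmorph0, rmorph_nat).
Qed.

Lemma tr_C_data i : (C_data e i)^T = C_data e i.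
Proof. by case: (ord2P i) => ->; mx_entries. Qed.

Lemma C_data0_zeta : C_data e 0 *m zeta C = - e *: (zeta C *m C_data e 1).
Proof. by case: e_sign => ->; mx_entries; field. Qed.

Lemma C_data1_zeta : C_data e 1 *m zeta C = - e *: (zeta C *m C_data e 0).
Proof. by case: e_sign => ->; mx_entries; field. Qed.

(** The grading is the volume element K made hermitian of square 1. *)
Lemma gamma_dataE : gamma_data e = - 'i *: comm (C_data e 0) (C_data e 1).
Proof. by rewrite /comm -!mulmxE; mx_entries; field. Qed.

Lemma C_data_pair :
  twisted_clifford_pair e (C_data e) (comm (C_data e 0) (C_data e 1)).
Proof.
split=> //; [exact: C_data_sq | exact: C_data_anticomm | exact: bar_C_data |
  exact: tr_C_data | exact: C_data0_zeta | exact: C_data1_zeta].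
Qed.

(** Common form of the two Dirac operators, before the sign of e is chosen. *)
Lemma slashD_M2E psi beta :
  slashD (spinor_M2 e) psi 0 beta
  = ('i / 2) *: \sum_alpha
      (C_data e 0 alpha beta *: (sigma1 *m psi 0 alpha + psi 0 alpha *m sigma2)
       + C_data e 1 alpha beta *: (sigma2 *m psi 0 alpha + psi 0 alpha *m sigma1)).
Proof.
rewrite [slashD _ _](slashDE _ _ _ _ C_data_pair) mxE !mulmx_embE -big_split scaler_sumr.
apply: eq_bigr => k _.
have two_sidedE (a b : A) : (a *: psi + psi *m b%:M) 0 k = a *m psi 0 k + psi 0 k *m b.
  by rewrite mxE mulmx_scalarE mxE.
rewrite !two_sidedE /theta.
move: (C_data e 0 k beta) (C_data e 1 k beta) (psi 0 k) => x y p.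
rewrite -!scalemxAl -!scalemxAr -!scalerDr [RHS]scalerDr !scalerA.
by rewrite ![_ * ('i / 2)]mulrC.
Qed.

Lemma C_data0E k beta :
  C_data e 0 k beta = 2^-1 * (sigma1 k beta - sigma3 k beta).
Proof. rewrite /C_data /= 2!mxE; congr (_ * (_ + _)); exact: mxE. Qed.

Lemma C_data1E k beta :
  C_data e 1 k beta = e / 2 * (sigma1 k beta + sigma3 k beta).
Proof. by rewrite /C_data /= 2!mxE. Qed.

Lemma slashD_even psi beta : e = -1 ->
  slashD (spinor_M2 e) psi 0 beta
  = - ('i / 4) *: \sum_alpha
      (sigma1 alpha beta *: comm (- sigma1 + sigma2) (psi 0 alpha)
       + sigma3 alpha beta *: acomm (sigma1 + sigma2) (psi 0 alpha)).
Proof.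
move=> e1; rewrite slashD_M2E !scaler_sumr; apply: eq_bigr => k _.
rewrite C_data0E C_data1E e1 /comm /acomm -!mulmxE.
rewrite !mulmxDl !mulmxDr mulNmx mulmxN.
move: (sigma1 k beta) (sigma3 k beta) (sigma1 *m psi 0 k) (sigma2 *m psi 0 k)
  (psi 0 k *m sigma1) (psi 0 k *m sigma2) => x z l1 l2 r1 r2.
by apply/matrixP=> i j; rewrite !mxE; field.
Qed.

Lemma slashD_odd psi beta : e = 1 ->
  slashD (spinor_M2 e) psi 0 beta
  = ('i / 4) *: \sum_alpha
      (sigma1 alpha beta *: acomm (sigma1 + sigma2) (psi 0 alpha)
       + sigma3 alpha beta *: comm (- sigma1 + sigma2) (psi 0 alpha)).
Proof.
move=> e1; rewrite slashD_M2E !scaler_sumr; apply: eq_bigr => k _.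
rewrite C_data0E C_data1E e1 /comm /acomm -!mulmxE.
rewrite !mulmxDl !mulmxDr mulNmx mulmxN.
move: (sigma1 k beta) (sigma3 k beta) (sigma1 *m psi 0 k) (sigma2 *m psi 0 k)
  (psi 0 k *m sigma1) (psi 0 k *m sigma2) => x z l1 l2 r1 r2.
by apply/matrixP=> i j; rewrite !mxE; field.
Qed.

Lemma M2_even_realised_triple :
  even_realised_triple (spinor_M2 e) (gamma_data e) 1 e 1.
Proof. by rewrite gamma_dataE; exact: pair_even_realised_triple _ _ _ _ C_data_pair. Qed.

Lemma M2_opJ_connesD psi :
  opJ (spinor_M2 e) (connesD (spinor_M2 e) psi)
  = - (e%:M : A) *: connesD (spinor_M2 e) (opJ (spinor_M2 e) psi).
Proof. exact: opJ_connesD _ _ _ _ C_data_pair psi. Qed.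

Lemma M2_KO_dimension_0 : e = -1 -> KO_dimension_0 (spinor_M2 e) (gamma_data e).
Proof.
move=> e1; split=> psi.
- exact: opJK.
- have m1 : - (e%:M : A) = 1 by rewrite e1 raddfN opprK.
  by rewrite M2_opJ_connesD m1 scale1r.
- by rewrite gamma_dataE; exact: opJ_grading _ _ _ _ C_data_pair psi.
Qed.

Lemma M2_KO_dimension_1 : e = 1 -> KO_dimension_1 (spinor_M2 e).
Proof.
move=> e1; split=> psi; first exact: opJK.
have m1 : - (e%:M : A) = - 1 by rewrite e1.
by rewrite M2_opJ_connesD m1 scaleN1r.
Qed.

End PauliData.

Theorem proposition4p8 (R : realType) (eps' : R[i])
    (heps' : eps' = 1 \/ eps' = -1) :
  even_realised_triple (spinor_M2 eps') (gamma_data eps') 1 eps' 1 /\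
  (eps' = -1 ->
     KO_dimension_0 (spinor_M2 eps') (gamma_data eps') /\
     forall (psi : 'rV['M[R[i]]_2]_2) (beta : 'I_2),
       slashD (spinor_M2 eps') psi 0 beta
       = - ('i / 4) *: \sum_alpha
           (sigma1 alpha beta *: comm (- sigma1 + sigma2) (psi 0 alpha)
            + sigma3 alpha beta *: acomm (sigma1 + sigma2) (psi 0 alpha))) /\
  (eps' = 1 ->
     realised_triple (spinor_M2 eps') 1 eps' /\
     KO_dimension_1 (spinor_M2 eps') /\
     forall (psi : 'rV['M[R[i]]_2]_2) (beta : 'I_2),
       slashD (spinor_M2 eps') psi 0 beta
       = ('i / 4) *: \sum_alpha
           (sigma1 alpha beta *: acomm (sigma1 + sigma2) (psi 0 alpha)
            + sigma3 alpha beta *: comm (- sigma1 + sigma2) (psi 0 alpha))).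
Proof.
have even := M2_even_realised_triple _ _ heps'.
split; first exact: even.
split=> e1.
  split; first exact: M2_KO_dimension_0 _ _ heps' e1.
  move=> psi beta; exact: slashD_even _ _ heps' psi beta e1.
split; first exact: ert_triple even.
split; first exact: M2_KO_dimension_1 _ _ heps' e1.
move=> psi beta; exact: slashD_odd _ _ heps' psi beta e1.
Qed.
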